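(* Let $\boldsymbol f^*\in\mathbb R^n$ be a (piecewise constant) vector such that $J^*=\{j\in[n]:f^*_j\ne f^*_{j-1}\}$ (with $f^*_0=0$) is nonempty, let $\sigma^*>0$, $\boldsymbol y=\boldsymbol f^*+\boldsymbol\xi$ with $\boldsymbol\xi\sim\mathcal N_n(0,\sigma^{*2}\mathbf I_n)$, $\delta\in(0,1)$ and $\lambda=2\sigma^*\{(2/n)\log(n/\delta)\}^{1/2}$. Then $$\mathbf P\Big(\frac1n\|\widehat{\boldsymbol f}^{\rm TV}-\boldsymbol f^*\|_2^2\le\frac{4\sigma^{*2}|J^*|\log(n/\delta)}{n}\cdot\big(3+256(\log(n)+n/\Delta_{\min,J^*})\big)\Big)\ge1-2\delta.$$
   Context: $[n]=\{1,\dots,n\}$. For $\boldsymbol f\in\mathbb R^n$, $\|\boldsymbol f\|_{\rm TV}=\sum_{i=1}^n|f_i-f_{i-1}|$ with the convention $f_0=0$. The TV-estimator is $\widehat{\boldsymbol f}^{\rm TV}\in\arg\min_{\boldsymbol f\in\mathbb R^n}\{\frac1{2n}\|\boldsymbol y-\boldsymbol f\|_2^2+\lambda\|\boldsymbol f\|_{\rm TV}\}$; equivalently, $\widehat{\boldsymbol f}^{\rm TV}=\mathbf X\widehat{\boldsymbol\beta}_\lambda$ with $\widehat{\boldsymbol\beta}_\lambda\in\arg\min_{\boldsymbol\beta}\{\frac1{2n}\|\boldsymbol y-\mathbf X\boldsymbol\beta\|_2^2+\lambda\|\boldsymbol\beta\|_1\}$ and $\mathbf X=(\mathbf 1\{i\ge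 j\})_{i,j\in[n]}$. For $T\subset[n]$, $\Delta_{\min,T}$ is the smallest distance between two consecutive distinct elements of $T\cup\{1,n+1\}$. ''Piecewise constant'' imposes no quantitative restriction on the vector. *)

(* Defs.v *)
From HB Require Import structures.
From mathcomp Require Import all_boot all_order all_algebra.
From mathcomp Require Import all_classical all_reals all_analysis.
Set Implicit Arguments.
Unset Strict Implicit.
Unset Printing Implicit Defensive.
Import Order.TTheory GRing.Theory Num.Theory.
Import numFieldNormedType.Exports.
Local Open Scope classical_set_scope.
Local Open Scope ring_scope.

(* Throughout, the 0-based ordinal i : 'I_n stands for the index i + 1 of
   {1, ..., n}. *)

(* f_(i-1), with the convention f_0 = 0. *)
Definition coord_pred (R : realType) (n : nat) (f : 'cV[R]_n) (i : 'I_n) : R :=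
  if i == 0%N :> nat then 0 else f (ord_pred i) 0.

Definition sqnorm2 (R : realType) (n : nat) (f : 'cV[R]_n) : R :=
  \sum_(i < n) f i 0 ^+ 2.

Definition TVnorm (R : realType) (n : nat) (f : 'cV[R]_n) : R :=
  \sum_(i < n) `|f i 0 - coord_pred f i|.

Definition TVobj (R : realType) (n : nat) (lambda : R) (y f : 'cV[R]_n) : R :=
  (2 * n%:R)^-1 * sqnorm2 (y - f) + lambda * TVnorm f.

Definition is_TV_estimator (R : realType) (n : nat) (lambda : R)
    (y fhat : 'cV[R]_n) : Prop :=
  forall f : 'cV[R]_n, TVobj lambda y fhat <= TVobj lambda y f.

Definition jumps (R : realType) (n : nat) (f : 'cV[R]_n) : {set 'I_n} :=
  [set j | f j 0 != coord_pred f j]%SET.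

(* T U {1, n+1}, again shifted by one: inside {0, ..., n}. *)
Definition knots (n : nat) (T : {set 'I_n}) : {set 'I_n.+1} :=
  (ord0 |: (ord_max |: [set widen_ord (leqnSn n) j | j in T]))%SET.

Definition consecutive (n : nat) (S : {set 'I_n}) (a b : 'I_n) : bool :=
  [&& a \in S, b \in S, (a < b)%N & [forall c in S, ~~ (a < c < b)%N]].

(* The default value n of the minimum is harmless: two knots are never at
   distance more than n, and for n > 0 there is always a consecutive pair. *)
Definition Delta_min (n : nat) (T : {set 'I_n}) : nat :=
  \big[minn/n]_(p : 'I_n.+1 * 'I_n.+1 | consecutive (knots T) p.1 p.2)
    (p.2 - p.1)%N.

(* The law N(m, v) on the line, where v is the variance; the library's
   normal_prob takes the standard deviation and is not the Dirac mass when
   that is zero. *)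
Definition normal_law (R : realType) (m v : R) (B : set R) : \bar R :=
  if v == 0 then \d_m B else normal_prob m (Num.sqrt v) B.

(* X ~ N_n(mu, Sigma), possibly degenerate: every linear form a^T X has law
   N(a^T mu, a^T Sigma a). *)
Definition gaussian_vector (d : measure_display) (T : measurableType d)
    (R : realType) (P : probability T R) (n : nat) (X : T -> 'cV[R]_n)
    (mu : 'cV[R]_n) (Sigma : 'M[R]_n) : Prop :=
  (forall i, measurable_fun [set: T] (fun w => X w i 0)) /\
  (forall (a : 'cV[R]_n) (B : set R), measurable B ->
     P ((fun w => (a^T *m X w) 0 0) @^-1` B) =
     normal_law ((a^T *m mu) 0 0) ((a^T *m Sigma *m a) 0 0) B).

(* Main.v *)
Require Import Defs.
From HB Require Import structures.
From mathcomp Require Import all_boot all_order all_algebra.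
From mathcomp Require Import all_classical all_reals all_analysis.
From mathcomp Require Import measurable_realfun ring lra zify.
Set Implicit Arguments.
Unset Strict Implicit.
Unset Printing Implicit Defensive.
Import Order.TTheory GRing.Theory Num.Theory.
Import numFieldNormedType.Exports.
Local Open Scope classical_set_scope.
Local Open Scope ring_scope.

(** Let u = fhat - fstar, let beta_j be its increments, so that
    u = sum_j beta_j x_j with x_j the step vector 1{i >= j}; let J be the jump
    set of fstar, s = |J|, D = Delta_min J and A = sigma (2 ln (n / delta))^(1/2),
    so that n lambda = 2 A n^(1/2).  Optimality of fhat
    ([TV_basic_inequality]) gives
      |u|^2 <= <xi, u> + n lambda (sum_J |beta_j| - sum_(J^c) |beta_j|).

    Noise.  Let Pi be the orthogonal projection onto span {x_t : t in J} and
    r_j = x_j - Pi x_j, which vanishes for j in J.  Then <xi, u> splits into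
    <Pi xi, u> and sum_(j notin J) beta_j <xi, r_j>.  Only n Gaussian linear
    forms occur: at most s coordinates of Pi xi and n - s residuals.  All of
    them are bounded by A times their norm outside an event of probability at
    most n * 2 exp (- ln (n / delta)) = 2 delta ([gaussian_union_bound]).
    There the first part is paid for by s A^2 + |u|^2 / 4 and the second one
    by A sum_(j notin J) |r_j| |beta_j| ([noise_decomp]).

    Compatibility.  Since Pi fixes x_t, |r_j| <= |x_j - x_t| = |j - t|^(1/2)
    for every t in J: the noise attached to a position is small near a true
    jump, and the penalty may be relaxed there.  It remains to bound
      sum_J |beta_j| - sum_(J^c) (1 - |r_j| / (2 n^(1/2))) |beta_j|.
    For any sequence q interpolating the signs of beta on J with
    |q_j| <= 1 - |r_j| / (2 n^(1/2)) off J, this is at most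
    sum_j q_j beta_j = <q_i - q_(i+1), u>, by summation by parts.  Taking for q
    a sum of signed spikes 1 - d^(1/2) / (2 n^(1/2)) - 2 d / D, with d the
    distance to a jump, the square root produces the harmonic sum ln n and the
    linear term produces n / D: n |q_i - q_(i+1)|^2 <= 2 s (ln n + 17 n / D)
    ([dual_cert_energy]).  Young's inequality then gives
    |u|^2 <= 2 A^2 (s + 8 s (ln n + 17 n / D)) ([oracle_inequality]).

    Measurability.  The estimator is a 1-Lipschitz function of the observation,
    as any proximal map is ([TV_estimator_lipschitz]), so the event in the
    statement is measurable and its probability dominates that of the event on
    which the noise is controlled. *)

(** * Inner product and orthogonal projection *)

Section Dot.
Context {R : realType} {n : nat}.
Implicit Types (a b u v w : 'cV[R]_n) (es vs : seq 'cV[R]_n).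

Definition dot u v : R := \sum_(i < n) u i 0 * v i 0.

Lemma dotC u v : dot u v = dot v u.
Proof. by apply: eq_bigr => i _; rewrite mulrC. Qed.

Lemma dotDl u v w : dot (u + v) w = dot u w + dot v w.
Proof. by rewrite /dot -big_split; apply: eq_bigr => i _; rewrite mxE mulrDl. Qed.

Lemma dotZl c u v : dot (c *: u) v = c * dot u v.
Proof. by rewrite /dot mulr_sumr; apply: eq_bigr => i _; rewrite mxE mulrA. Qed.

Lemma dotNl u v : dot (- u) v = - dot u v.
Proof. by rewrite -scaleN1r dotZl mulN1r. Qed.

Lemma dotBl u v w : dot (u - v) w = dot u w - dot v w.
Proof. by rewrite dotDl dotNl. Qed.

Lemma dotZr c u v : dot u (c *: v) = c * dot u v.
Proof. by rewrite ![dot u _]dotC dotZl. Qed.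

Lemma dotNr u v : dot u (- v) = - dot u v.
Proof. by rewrite ![dot u _]dotC dotNl. Qed.

Lemma dotBr u v w : dot u (v - w) = dot u v - dot u w.
Proof. by rewrite ![dot u _]dotC dotBl. Qed.

Lemma dot0l v : dot 0 v = 0.
Proof. by rewrite -(scale0r 0) dotZl mul0r. Qed.

Lemma dot_suml (I : Type) (r : seq I) (Q : pred I) (F : I -> 'cV[R]_n) v :
  dot (\sum_(i <- r | Q i) F i) v = \sum_(i <- r | Q i) dot (F i) v.
Proof. by elim/big_rec2: _ => [|i x y _ <-]; rewrite ?dot0l ?dotDl. Qed.

Lemma dot_sumr (I : Type) (r : seq I) (Q : pred I) (F : I -> 'cV[R]_n) v :
  dot v (\sum_(i <- r | Q i) F i) = \sum_(i <- r | Q i) dot v (F i).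
Proof. by rewrite dotC dot_suml; apply: eq_bigr => i _; rewrite dotC. Qed.

Lemma dot_ge0 u : 0 <= dot u u.
Proof. by apply: sumr_ge0 => i _; rewrite -expr2 sqr_ge0. Qed.

Lemma dot_eq0 u : dot u u = 0 -> u = 0.
Proof.
move/eqP; rewrite psumr_eq0 => [/allP u0|i _]; last by rewrite -expr2 sqr_ge0.
apply/colP => i; rewrite mxE.
by have := u0 i (mem_index_enum i); rewrite -expr2 sqrf_eq0 => /eqP.
Qed.

Lemma sqnorm_subZ t u v :
  dot (u - t *: v) (u - t *: v) =
  dot u u - 2 * (t * dot u v) + t * (t * dot v v).
Proof. by rewrite dotBl !dotBr !dotZr !dotZl (dotC v u); ring. Qed.

Lemma sqnorm2E u : sqnorm2 u = dot u u.
Proof. by apply: eq_bigr => i _; rewrite expr2. Qed.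

Lemma mul_trE u v : (u^T *m v) 0 0 = dot u v.
Proof. by rewrite mxE; apply: eq_bigr => i _; rewrite mxE. Qed.

(** Coordinatewise, the gap is c (u_i - v_i / (2 c))^2. *)
Lemma young_dot c u v : 0 < c -> dot u v <= c * dot u u + (4 * c)^-1 * dot v v.
Proof.
move=> c0; rewrite /dot !mulr_sumr -big_split; apply: ler_sum => i _ /=.
rewrite -subr_ge0.
suff -> : c * (u i 0 * u i 0) + (4 * c)^-1 * (v i 0 * v i 0) - u i 0 * v i 0 =
    c * (u i 0 - v i 0 / (2 * c)) ^+ 2.
  by rewrite mulr_ge0 ?sqr_ge0// ltW.
by field; rewrite gt_eqF.
Qed.

Definition proj es v : 'cV[R]_n := \sum_(e <- es) dot v e *: e.

(** The second clause says that [proj es] leaves a residual orthogonal to [es].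
    For unit vectors this amounts to pairwise orthogonality of the members of
    the list (repetitions excluded), but it is the form in which orthogonality
    is used, and it survives the adjunction of a vector directly. *)
Definition orthonormal_seq es : Prop :=
  (forall e, e \in es -> dot e e = 1) /\
  (forall v e, e \in es -> dot (v - proj es v) e = 0).

Lemma proj_orth es u v :
  orthonormal_seq es -> dot (u - proj es u) (proj es v) = 0.
Proof.
move=> [_ orth]; rewrite dot_sumr big_seq big1// => e ein.
by rewrite dotZr orth ?mulr0.
Qed.

Lemma sqnorm_residual es v : orthonormal_seq es ->
  dot (v - proj es v) (v - proj es v) = dot v v - \sum_(e <- es) dot v e ^+ 2.
Proof.
move=> on; rewrite dotBr (proj_orth _ _ on) subr0 dotBl /proj dot_suml.
by congr (_ - _); apply: eq_bigr => e _; rewrite dotZl expr2 (dotC e).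
Qed.

Lemma bessel es v : orthonormal_seq es -> \sum_(e <- es) dot v e ^+ 2 <= dot v v.
Proof. by move=> on; rewrite -subr_ge0 -sqnorm_residual// dot_ge0. Qed.

Lemma projB es u v : proj es (u - v) = proj es u - proj es v.
Proof.
rewrite /proj -sumrB; apply: eq_bigr => e _.
by rewrite dotBl scalerBl.
Qed.

(** The projection of v is its nearest point in the span: v and v - w have the
    same residual when w is in the span, and taking residuals decreases norms. *)
Lemma residual_le es v w : orthonormal_seq es -> proj es w = w ->
  dot (v - proj es v) (v - proj es v) <= dot (v - w) (v - w).
Proof.
move=> on wE.
have -> : v - proj es v = (v - w) - proj es (v - w).
  by rewrite projB wE opprB addrA subrK.
rewrite sqnorm_residual// gerBl; apply: sumr_ge0 => e _; exact: sqr_ge0.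
Qed.

(** Gram-Schmidt: a new vector contributes its normalized residual, or nothing
    when it already lies in the span. *)
Lemma gram_schmidt vs : exists es, [/\ (size es <= size vs)%N,
  orthonormal_seq es & forall v, v \in vs -> proj es v = v].
Proof.
elim: vs => [|v0 vs [es [les on rep]]].
  by exists [::]; split => //; split.
have [unit orth] := on.
set r := v0 - proj es v0.
have [r0|rN0] := eqVneq r 0.
  exists es; split; [exact: leqW|exact: on|move=> v].
  rewrite inE => /orP[/eqP ->|]; last exact: rep.
  by apply/eqP; rewrite eq_sym -subr_eq0 -/r r0.
have rr_gt0 : 0 < dot r r.
  rewrite lt_neqAle dot_ge0 andbT eq_sym; apply: contra_neq rN0.
  exact: dot_eq0.
set nr := Num.sqrt (dot r r).
have nr_gt0 : 0 < nr by rewrite sqrtr_gt0.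
have nrE : nr * nr = dot r r by rewrite -expr2 sqr_sqrtr ?dot_ge0.
pose e0 := nr^-1 *: r.
have pr0 v : dot (proj es v) e0 = 0.
  by rewrite dotZr dotC (proj_orth _ _ on) mulr0.
have e0e e : e \in es -> dot e0 e = 0.
  by move=> ein; rewrite dotZl orth// mulr0.
have e00 : dot e0 e0 = 1.
  rewrite dotZl dotZr -nrE; field; exact: lt0r_neq0.
have proj_cons v : proj (e0 :: es) v = dot v e0 *: e0 + proj es v.
  by rewrite /proj big_cons.
exists (e0 :: es); split => //.
  split=> [e|v e]; rewrite inE => /orP[/eqP ->//|ein].
  - exact: unit.
  - rewrite proj_cons opprD addrCA dotDl dotNl dotZl e00 dotBl pr0.
    by rewrite mulr1 subr0 addrC subrr.
  - by rewrite proj_cons opprD addrCA dotDl dotNl dotZl e0e// orth// mulr0 oppr0 addr0.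
move=> v; rewrite proj_cons inE => /orP[/eqP ->|vin].
  have -> : dot v0 e0 = nr.
    have -> : v0 = r + proj es v0 by rewrite subrK.
    by rewrite dotDl pr0 addr0 dotZr -nrE mulKf// gt_eqF.
  by rewrite scalerA mulfV ?gt_eqF// scale1r subrK.
by rewrite -{1}(rep v vin) pr0 scale0r add0r rep.
Qed.

End Dot.

(** * Increments, total variation and optimality conditions *)

Section TotalVariation.
Context {R : realType} {n : nat}.
Implicit Types (f g u y : 'cV[R]_n) (i j : 'I_n) (lambda : R).

Definition incr u i : R := u i 0 - coord_pred u i.

(** A column of the design matrix of the Lasso form of the estimator. *)
Definition step_vec j : 'cV[R]_n := \col_i (j <= i)%N%:R.

Lemma coord_pred_lin a b f g i :
  coord_pred (a *: f + b *: g) i = a * coord_pred f i + b * coord_pred g i.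
Proof.
by rewrite /coord_pred; case: ifP => _; rewrite ?mulr0 ?addr0// !mxE.
Qed.

Lemma incr_lin a b f g i :
  incr (a *: f + b *: g) i = a * incr f i + b * incr g i.
Proof. by rewrite /incr coord_pred_lin !mxE; ring. Qed.

(** Telescoping of the increments, with the convention u_0 = 0. *)
Lemma step_decomp u : u = \sum_(j < n) incr u j *: step_vec j.
Proof.
pose F (k : nat) : R :=
  if k is k'.+1 then oapp (fun i : 'I_n => u i 0) 0 (insub k') else 0.
have FS i : F i.+1 = u i 0 by rewrite /F /= valK.
have FE i : F i = coord_pred u i.
  rewrite /coord_pred; case: (posnP i) => [->//|i_gt0].
  rewrite -FS; congr F => /=.
  have -> : (i + n).-1 = (i.-1 + n)%N by lia.
  by have := ltn_ord i; rewrite modnDr => ?; rewrite modn_small; lia.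
apply/colP => i; rewrite summxE -FS.
rewrite -[LHS]subr0 -[0]/(F 0%N) -telescope_sumr// big_mkord.
rewrite (big_ord_widen n (fun k => F k.+1 - F k))// big_mkcond.
apply: eq_bigr => j _; rewrite !mxE ltnS /incr -FS -FE.
by case: ifP; rewrite ?mulr1 ?mulr0.
Qed.

Lemma dot_step_diff (q : nat -> R) j : q n = 0 ->
  dot (step_vec j) (\col_i (q i - q i.+1)) = q j.
Proof.
move=> qn.
transitivity (\sum_(j <= k < n) (q k - q k.+1)).
  rewrite big_geq_mkord big_mkcond /=; apply: eq_bigr => i _; rewrite !mxE.
  by case: leqP; rewrite ?mul1r ?mul0r.
apply: oppr_inj; transitivity (q n - q j); last by rewrite qn sub0r.
rewrite -telescope_sumr ?(ltnW (ltn_ord j))// -sumrN.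
by apply: eq_bigr => k _; rewrite opprB.
Qed.

(** Summation by parts; the boundary term at n vanishes by hypothesis. *)
Lemma dot_diff (q : nat -> R) u : q n = 0 ->
  \sum_(j < n) q j * incr u j = dot (\col_i (q i - q i.+1)) u.
Proof.
move=> qn; rewrite [X in dot _ X]step_decomp dot_sumr; apply: eq_bigr => j _.
by rewrite dotZr dotC dot_step_diff// mulrC.
Qed.

(** Two step vectors differ exactly on the indices between their jumps. *)
Lemma step_sub_sqnorm i j :
  dot (step_vec i - step_vec j) (step_vec i - step_vec j) <= `|i%:R - j%:R|.
Proof.
wlog ij : i j / (i <= j)%N.
  move=> H; case: (leqP i j) => [|/ltnW] /H //.
  by rewrite distrC -opprB dotNl dotNr opprK.
rewrite distrC ger0_norm ?subr_ge0 ?ler_nat// -natrB//.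
have -> : (j - i)%:R = \sum_(i <= k < j) (1 : R).
  by rewrite big_const_nat iter_addr addr0.
rewrite (big_nat_widen _ _ _ _ _ (ltnW (ltn_ord j))) big_geq_mkord big_mkcond /=.
apply: ler_sum => k _; rewrite !mxE.
case: (leqP i k) => ik; case: (leqP j k) => jk;
  rewrite /= ?subrr ?subr0 ?mulr0 ?mulr1 ?lexx//; exfalso; lia.
Qed.

Lemma step_sqnorm j : dot (step_vec j) (step_vec j) <= n%:R.
Proof.
rewrite -[X in X%:R]card_ord -sum1_card natr_sum; apply: ler_sum => k _.
by rewrite !mxE; case: leqP => _; rewrite /= ?mulr1 ?mulr0 ?lexx ?ler01.
Qed.

Lemma TVnorm_convex (t : R) f g : 0 <= t <= 1 ->
  TVnorm ((1 - t) *: f + t *: g) <= (1 - t) * TVnorm f + t * TVnorm g.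
Proof.
move=> /andP[t0 t1]; rewrite /TVnorm !mulr_sumr -big_split; apply: ler_sum => i _.
rewrite -/(incr _ i) incr_lin (le_trans (ler_normD _ _))// !normrM.
by rewrite (ger0_norm t0) ger0_norm ?subr_ge0.
Qed.

(** First-order optimality.  The objective at g is at most its value at
    (1 - t) g + t f; convexity of the total variation bounds the penalty there,
    and dividing by t and letting t tend to 0 removes the quadratic term. *)
Lemma TV_variational lambda y g : (0 < n)%N -> 0 <= lambda ->
  is_TV_estimator lambda y g ->
  forall f, dot (y - g) (f - g) <= n%:R * lambda * (TVnorm f - TVnorm g).
Proof.
move=> n0 l0 gmin f; apply/ler_addgt0Pr => e e0.
set v := f - g; set c := dot v v.
have c0 : 0 <= c by exact: dot_ge0.
have ce0 : 0 < c + 1 + e by lra.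
(* This t lies in (0, 1] and makes the quadratic remainder t |f - g|^2 at
   most e. *)
pose t := e / (c + 1 + e).
have t0 : 0 < t by rewrite divr_gt0.
have t1 : t <= 1 by rewrite ler_pdivrMr//; lra.
have n0R : (0 : R) < n%:R by rewrite ltr0n.
have tce : t * c <= e.
  by rewrite /t mulrAC ler_pdivrMr// ler_wpM2l ?ltW//; lra.
have := gmin ((1 - t) *: g + t *: f); rewrite /TVobj !sqnorm2E.
have -> : y - ((1 - t) *: g + t *: f) = (y - g) - t *: v.
  by rewrite /v; apply/colP => i; rewrite !mxE; ring.
have := @TVnorm_convex t g f; rewrite (ltW t0) t1 => /(_ isT) cvx.
have {cvx}cvx : lambda * TVnorm ((1 - t) *: g + t *: f) <=
    lambda * TVnorm g + t * (lambda * (TVnorm f - TVnorm g)).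
  apply: le_trans (ler_wpM2l l0 cvx) _; rewrite le_eqVlt; apply/orP; left; apply/eqP; ring.
set z := y - g; rewrite sqnorm_subZ -/c => opt.
have {opt cvx} : t * dot z v <= t * (n%:R * lambda * (TVnorm f - TVnorm g) + t * c / 2).
  have {opt cvx} := le_trans opt (lerD (lexx _) cvx).
  set a := dot z v; set b := dot z z; set X := lambda * TVnorm g.
  set Y := lambda * (TVnorm f - TVnorm g) => h.
  have := ler_wpM2l (ltW n0R) h.
  have -> : n%:R * ((2 * n%:R)^-1 * b + X) = b / 2 + n%:R * X by field; lra.
  have -> : n%:R * ((2 * n%:R)^-1 * (b - 2 * (t * a) + t * (t * c)) + (X + t * Y)) =
     (b - 2 * (t * a) + t * (t * c)) / 2 + n%:R * X + t * (n%:R * Y) by field; lra.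
  rewrite -(mulrA n%:R) -/Y; nra.
rewrite ler_pM2l//; lra.
Qed.

(** Summing the variational inequalities of the two estimators, each tested at
    the other one, cancels the penalties and leaves
    |g - g'|^2 <= <y - y', g - g'>. *)
Lemma TV_estimator_lipschitz lambda y y' g g' : (0 < n)%N -> 0 <= lambda ->
  is_TV_estimator lambda y g -> is_TV_estimator lambda y' g' ->
  dot (g - g') (g - g') <= dot (y - y') (y - y').
Proof.
move=> n0 l0 /(TV_variational n0 l0)/(_ g') h /(TV_variational n0 l0)/(_ g) h'.
have hs : dot (g - g') (g - g') <= dot (y - y') (g - g').
  move: h h'; rewrite !(dotBl, dotBr) (dotC g' g); nra.
have := @young_dot R n 2^-1 (y - y') (g - g') ltac:(lra).
have -> : (4 * 2^-1)^-1 = 2^-1 :> R by field.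
lra.
Qed.

(** The variational inequality tested at f.  Outside [jumps f] the increments of
    f vanish, so those of g and g - f agree there; on [jumps f] the triangle
    inequality is enough. *)
Lemma TV_basic_inequality lambda y f g : (0 < n)%N -> 0 <= lambda ->
  is_TV_estimator lambda y g ->
  dot (g - f) (g - f) <= dot (y - f) (g - f) +
    n%:R * lambda * (\sum_(j in jumps f) `|incr (g - f) j| -
                     \sum_(j in ~: jumps f) `|incr (g - f) j|).
Proof.
move=> n0 l0 /(TV_variational n0 l0)/(_ f) h.
have split_ h' : \sum_(j < n) h' j =
    \sum_(j in jumps f) h' j + \sum_(j in ~: jumps f) h' j :> R.
  rewrite (bigID (mem (jumps f))) /=; congr (_ + _).
  by apply: eq_bigl => j; rewrite finset.in_setC.
have tv : TVnorm f - TVnorm g <= \sum_(j in jumps f) `|incr (g - f) j| -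
                     \sum_(j in ~: jumps f) `|incr (g - f) j|.
  have gE j : incr g j = incr f j + incr (g - f) j.
    have -> : g - f = 1 *: g + (-1) *: f by rewrite scale1r scaleN1r.
    by rewrite incr_lin; ring.
  rewrite /TVnorm -sumrB split_ -[X in _ <= _ + X]sumrN.
  apply: lerD; apply: ler_sum => j; rewrite -!/(incr _ j).
    move=> _; rewrite gE lerBlDr addrC.
    by have := ler_normB (incr f j + incr (g - f) j) (incr (g - f) j); rewrite addrK.
  rewrite !inE negbK => /eqP fj.
  have f0 : incr f j = 0 by rewrite /incr fj subrr.
  by rewrite gE f0 normr0 !add0r.
have := ler_wpM2l (mulr_ge0 (ler0n R n) l0) tv.
move: h; rewrite !(dotBl, dotBr) (dotC f g); nra.
Qed.

End TotalVariation.

(** * The dual certificate *)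

Section Separation.
Context {n : nat}.
Implicit Types (T : {set 'I_n}) (a b : 'I_n.+1) (t : 'I_n).

(** The closest knot to the right of a is consecutive to a and does not exceed
    b. *)
Lemma Delta_min_le_knots T a b : a \in knots T -> b \in knots T -> (a < b)%N ->
  (Delta_min T <= b - a)%N.
Proof.
move=> aT bT ab.
case: (arg_minnP (fun c : 'I_n.+1 => c : nat) (P := fun c => (c \in knots T) && (a < c)%N)
  (i0 := b)); first by rewrite bT.
move=> c /andP[cT ac] cmin.
apply: (@leq_trans (c - a)); last by apply: leq_sub2r; apply: cmin; rewrite bT.
rewrite /Delta_min -leEnat -minEnat.
apply: (bigmin_le_cond n (fun p : 'I_n.+1 * 'I_n.+1 => (p.2 - p.1)%N) (j := (a, c))).
rewrite /= /consecutive aT cT ac /=; apply/forall_inP => e eT.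
by apply/negP => /andP[ae]; rewrite ltnNge cmin// eT.
Qed.

Lemma Delta_min_sep T t t' : t \in T -> t' \in T -> (t < t')%N ->
  (Delta_min T <= t' - t)%N.
Proof.
move=> tT t'T tt'.
apply: (@Delta_min_le_knots T (widen_ord (leqnSn n) t) (widen_ord (leqnSn n) t')) => //.
- by rewrite !inE imset_f ?orbT.
- by rewrite !inE imset_f ?orbT.
Qed.

Lemma Delta_min_last T t : t \in T -> (Delta_min T <= n - t)%N.
Proof.
move=> tT; apply: (@Delta_min_le_knots T (widen_ord (leqnSn n) t) ord_max) => /=.
- by rewrite !inE imset_f ?orbT.
- by rewrite !inE eqxx orbT.
- exact: ltn_ord.
Qed.

Lemma Delta_min_le T : (Delta_min T <= n)%N.
Proof. by rewrite /Delta_min -leEnat -minEnat; exact: bigmin_le_id. Qed.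

Lemma Delta_min_gt0 T : (0 < n)%N -> (0 < Delta_min T)%N.
Proof.
move=> n0; rewrite /Delta_min; apply: (big_ind (fun m => (0 < m)%N)) => // [x y x0 y0|p].
  by rewrite leq_min x0.
by move=> /and4P[_ _ + _]; rewrite subn_gt0.
Qed.

End Separation.

Section Spike.
Context {R : realType}.
Implicit Types (a : R) (D d : nat).

(** A bump around 0 with value 1 at d = 0 and vanishing from d = D / 2 on, so
    that spikes centred at points D apart do not overlap.  The square root
    leaves room for a noise level of order d^(1/2) near the centre; the linear
    term brings the spike down to 0. *)
Definition spike a D d : R := Num.max 0 (1 - a * Num.sqrt d%:R - 2 * d%:R / D%:R).

Lemma spike_ge0 a D d : 0 <= spike a D d.
Proof. by rewrite /spike le_max lexx. Qed.

Lemma spike0 a D : spike a D 0 = 1.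
Proof. by rewrite /spike sqrtr0 !mulr0 mul0r !subr0 max_r. Qed.

Lemma spike_far a D d : 0 <= a -> (0 < D)%N -> (D <= 2 * d)%N -> spike a D d = 0.
Proof.
move=> a0 D0 Dd; rewrite /spike max_l//.
have : 1 <= 2 * d%:R / D%:R :> R.
  by rewrite ler_pdivlMr ?ltr0n// mul1r -natrM ler_nat.
have := mulr_ge0 a0 (sqrtr_ge0 d%:R); lra.
Qed.

Lemma spike_le a D d : spike a D d != 0 -> spike a D d <= 1 - a * Num.sqrt d%:R.
Proof.
rewrite /spike; set x := 1 - _ - _; case: (leP 0 x) => [_ _|]; last by rewrite eqxx.
by rewrite gerBl divr_ge0// mulr_ge0.
Qed.

(** The step (d + 1)^(1/2) - d^(1/2) is at most (d + 1)^(-1/2), because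
    its product with the sum of the two roots is 1; truncation at 0 does not
    increase differences. *)
Lemma spike_diff a D d : 0 <= a ->
  (spike a D d - spike a D d.+1) ^+ 2 <=
  2 * a ^+ 2 / d.+1%:R + 8 / D%:R ^+ 2.
Proof.
move=> a0; set p := Num.sqrt d.+1%:R : R; set r := Num.sqrt d%:R : R.
have p2 : p ^+ 2 = d.+1%:R by rewrite sqr_sqrtr.
have r2 : r ^+ 2 = d%:R by rewrite sqr_sqrtr.
have r0 : 0 <= r by exact: sqrtr_ge0.
have rp : r <= p by rewrite ler_wsqrtr ?ler_nat.
set i := 1 / D%:R : R; have i0 : 0 <= i by rewrite divr_ge0.
have pr : (p - r) * (p + r) = 1 by rewrite -subr_sqr p2 r2 -addn1 natrD; ring.
have pr2 : (p - r) ^+ 2 <= d.+1%:R^-1.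
  rewrite -p2 -[leRHS]mul1r ler_pdivlMr; last by rewrite p2 ltr0n.
  rewrite -exprMn -[leRHS](expr1n _ 2) ler_sqr ?nnegrE; last 2 first.
    by rewrite mulr_ge0 ?subr_ge0// (le_trans r0).
    exact: ler01.
  by rewrite -pr ler_wpM2l ?subr_ge0// lerDl.
set x := 1 - a * r - 2 * d%:R / D%:R.
set y := 1 - a * p - 2 * d.+1%:R / D%:R.
have xy : x - y = a * (p - r) + 2 * i.
  by rewrite /x /y /i -addn1 natrD; ring.
have xy0 : 0 <= x - y by rewrite xy addr_ge0 ?mulr_ge0 ?subr_ge0.
have : (spike a D d - spike a D d.+1) ^+ 2 <= (x - y) ^+ 2.
  rewrite /spike -/p -/r -/x -/y.
  case: (leP 0 x) => hx; case: (leP 0 y) => hy //; first by nra.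
    by lra.
  by rewrite subr0 expr0n sqr_ge0.
move/le_trans; apply; rewrite xy.
have := sqr_ge0 (a * (p - r) - 2 * i).
have := ler_wpM2l (sqr_ge0 a) pr2; rewrite -exprMn.
have -> : 2 * a ^+ 2 / d.+1%:R = 2 * (a ^+ 2 * d.+1%:R^-1) by ring.
have -> : 8 / D%:R ^+ 2 = 8 * i ^+ 2 by rewrite /i exprMn exprVn expr1n mul1r.
move: (a * (p - r)) (a ^+ 2 * _) => E K; nra.
Qed.

(** By induction, from 1 / (k + 1) <= ln (k + 1) - ln k. *)
Lemma harmonic_le_ln m : (0 < m)%N ->
  \sum_(d < m) d.+1%:R^-1 <= 1 + ln m%:R :> R.
Proof.
case: m => // m _; elim: m => [|m IH].
  by rewrite big_ord_recr big_ord0 /= ln1 invr1 addr0 add0r.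
rewrite big_ord_recr /= (le_trans (lerD IH (lexx _)))//.
set k := m.+1%:R : R; have k0 : 0 < k by rewrite ltr0n.
have -> : m.+2%:R = k + 1 by rewrite -addn1 natrD.
have : ln (1 + (- (k + 1)^-1)) <= - (k + 1)^-1.
  by apply: le_ln1Dx; rewrite ltrN2 invf_lt1; lra.
have -> : 1 - (k + 1)^-1 = k / (k + 1) by field; lra.
rewrite ln_div ?posrE//; lra.
Qed.

End Spike.

Lemma sqr_sum_disjoint (R : realType) (n : nat) (Q : pred 'I_n) (x : 'I_n -> R) :
  (forall t t', Q t -> Q t' -> (t < t')%N -> x t * x t' = 0) ->
  (\sum_(t | Q t) x t) ^+ 2 = \sum_(t | Q t) x t ^+ 2.
Proof.
move=> disj; rewrite expr2 big_distrlr; apply: eq_bigr => t Qt.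
rewrite (bigD1 t)//= big1 ?addr0 -?expr2// => t' /andP[Qt'].
by rewrite -val_eqE neq_ltn => /orP[] lt; [rewrite mulrC|]; exact: disj.
Qed.

(** The distance |k - t| in nat. *)
Definition gap (k t : nat) : nat := ((k - t) + (t - k))%N.

Section Certificate.
Context {R : realType} {n : nat}.
Variables (J : {set 'I_n}) (s : 'I_n -> R) (D : nat).
Hypothesis s1 : forall t, `|s t| <= 1.
Hypothesis D0 : (0 < D)%N.
Hypothesis Dn : (D <= n)%N.
Hypothesis sepJ : forall t t', t \in J -> t' \in J -> (t < t')%N -> (D <= t' - t)%N.
Hypothesis lastJ : forall t, t \in J -> (D <= n - t)%N.

Let a : R := (2 * Num.sqrt n%:R)^-1.

(** The interpolating sequence: it equals s on J, where s is to be the sequence of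
    signs of the increments of the error. *)
Definition dual_cert (k : nat) : R := \sum_(t in J) s t * spike a D (gap k t).

Let a0 : 0 <= a.
Proof. by rewrite invr_ge0 mulr_ge0 ?sqrtr_ge0. Qed.

Let n0 : (0 < n)%N. Proof. exact: leq_trans Dn. Qed.

Let sepN t t' : t \in J -> t' \in J -> t != t' -> (D <= gap t t')%N.
Proof.
move=> tJ t'J; rewrite -val_eqE neq_ltn => /orP[] /sepJ; rewrite /gap.
- by move=> /(_ tJ t'J) h; rewrite (leq_trans h)// leq_addl.
- by move=> /(_ t'J tJ) h; rewrite (leq_trans h)// leq_addr.
Qed.

Lemma dual_cert_end : dual_cert n = 0.
Proof.
apply: big1 => t tJ; rewrite spike_far ?mulr0//.
by rewrite /gap; have := lastJ tJ; lia.
Qed.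

(** Within D / 2 of a point t of J, every other point of J is more than D / 2
    away, so a single spike is active. *)
Lemma dual_cert_close (k : nat) t : t \in J -> (2 * gap k t < D)%N ->
  dual_cert k = s t * spike a D (gap k t).
Proof.
move=> tJ kt; rewrite /dual_cert (bigD1 t)//= big1 ?addr0// => t' /andP[t'J t't].
rewrite spike_far ?mulr0//.
by have := sepN t'J tJ t't; rewrite /gap in kt *; lia.
Qed.

Lemma dual_cert_knot t : t \in J -> dual_cert t = s t.
Proof.
move=> tJ; have gtt : gap t t = 0%N by rewrite /gap subnn.
by rewrite (dual_cert_close tJ) gtt ?muln0// spike0 mulr1.
Qed.

(** Near a point of J the square root in the active spike absorbs a w; away from
    J the certificate is 0 and a w <= 1 / 2. *)
Lemma dual_cert_feasible (k : nat) (w : R) : 0 <= w -> w <= Num.sqrt n%:R ->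
  (forall t, t \in J -> w <= Num.sqrt (gap k t)%:R) ->
  `|dual_cert k| <= 1 - a * w.
Proof.
move=> w0 wn wJ.
have rn0 : 0 < Num.sqrt n%:R :> R by rewrite sqrtr_gt0 ltr0n.
have aw : a * w <= 2^-1.
  apply: le_trans (ler_wpM2l a0 wn) _.
  by rewrite /a invfM -mulrA mulVf ?mulr1// gt_eqF.
have [/existsP[t /andP[tJ kt]]|] := boolP [exists t, (t \in J) && (2 * gap k t < D)%N].
  rewrite (dual_cert_close tJ kt).
  have [->|sN0] := eqVneq (spike a D (gap k t)) 0; first by rewrite mulr0 normr0; lra.
  rewrite normrM (ger0_norm (spike_ge0 _ _ _)).
  apply: le_trans (ler_wpM2r (spike_ge0 _ _ _) (s1 t)) _; rewrite mul1r.
  apply: le_trans (spike_le sN0) _.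
  by rewrite lerD2l lerN2 ler_wpM2l// wJ.
rewrite negb_exists => /forallP far; rewrite /dual_cert big1 ?normr0; first lra.
move=> t tJ; rewrite spike_far ?mulr0//.
by have := far t; rewrite tJ /= -leqNgt.
Qed.

Let delta (d : nat) : R := (spike a D d - spike a D d.+1) ^+ 2.

Let delta_sum : \sum_(d < n) delta d <= (1 + ln n%:R) / (2 * n%:R) + 8 / D%:R.
Proof.
have far d : (D <= d)%N -> delta d = 0.
  by move=> Dd; rewrite /delta !spike_far ?subrr ?expr0n//; lia.
have -> : \sum_(d < n) delta d = \sum_(d < D) delta d.
  rewrite (big_ord_widen n (fun d => delta d) Dn) [RHS]big_mkcond.
  by apply: eq_bigr => d _; case: ltnP => // /far.
have a2 : 2 * a ^+ 2 = (2 * n%:R)^-1.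
  rewrite /a exprVn exprMn sqr_sqrtr//; field.
  by rewrite pnatr_eq0 -lt0n.
apply: (@le_trans _ _ (\sum_(d < D) ((2 * n%:R)^-1 * d.+1%:R^-1 + 8 / D%:R ^+ 2))).
  by apply: ler_sum => d _; rewrite -a2 spike_diff.
rewrite big_split /= -mulr_sumr sumr_const card_ord mulrC.
have D0R : D%:R != 0 :> R by rewrite pnatr_eq0 -lt0n.
apply: lerD; last by rewrite -[X in X <= _]mulr_natr le_eqVlt; apply/orP; left; apply/eqP; field.
rewrite ler_wpM2r ?invr_ge0 ?mulr_ge0//.
apply: le_trans (@harmonic_le_ln R _ D0) _.
by rewrite lerD2l ler_ln ?posrE ?ltr0n// ler_nat.
Qed.

Let g (t : 'I_n) (i : nat) : R := spike a D (gap i t) - spike a D (gap i.+1 t).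

Let g_sum t : \sum_(i < n) g t i ^+ 2 <= 2 * \sum_(d < n) delta d.
Proof.
rewrite (bigID (fun i : 'I_n => (t <= i)%N)) /= mulr_natl mulr2n.
have dge0 d : 0 <= delta d by exact: sqr_ge0.
apply: lerD.
  rewrite (eq_bigr (fun i : 'I_n => delta (i - t))); last first.
    move=> i ti; rewrite /g /delta /gap; congr ((spike _ _ _ - spike _ _ _) ^+ 2); lia.
  rewrite -(big_geq_mkord t n xpredT (fun i => delta (i - t))) -{1}[t : nat]add0n big_addn.
  under eq_bigr do rewrite addnK.
  rewrite big_mkord (big_ord_widen n delta (leq_subr _ _)) big_mkcond.
  by apply: ler_sum => i _; case: ifP.
rewrite (eq_bigr (fun i : 'I_n => delta (t - i.+1))); last first.
  move=> i; rewrite -ltnNge => ti; rewrite /g /delta /gap -sqrrN opprB.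
  congr ((spike _ _ _ - spike _ _ _) ^+ 2); lia.
under eq_bigl do rewrite -ltnNge.
rewrite -(big_ord_widen n (fun i => delta (t - i.+1)) (ltnW (ltn_ord t))).
rewrite -(big_mkord xpredT (fun i => delta (t - i.+1))) big_nat_rev /= add0n.
rewrite big_mkord (big_ord_widen n (fun i => delta (t - (t - i.+1).+1)) (ltnW (ltn_ord t))).
rewrite big_mkcond; apply: ler_sum => i _; case: ifP => // it.
by have -> : (t - (t - i.+1).+1 = i)%N by lia.
Qed.

(** An increment of the certificate collects the spikes centred at or to the left
    of i, and those centred to the right; by separation each group has at most
    one nonzero term, so its square is the sum of the squares.  Summing over i,
    every spike contributes twice (once on each side) the energy of its profile,
    at most (1 + ln n) / (2 n) + 8 / D.  Finally 1 <= n / D absorbs the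
    constant. *)
Lemma dual_cert_energy :
  n%:R * \sum_(i < n) (dual_cert i - dual_cert i.+1) ^+ 2 <=
  2 * #|J|%:R * (ln n%:R + 17 * (n%:R / D%:R)).
Proof.
have step1 (i : 'I_n) : (dual_cert i - dual_cert i.+1) ^+ 2 <=
    2 * \sum_(t in J) g t i ^+ 2.
  have -> : dual_cert i - dual_cert i.+1 = \sum_(t in J) s t * g t i.
    by rewrite -sumrB; apply: eq_bigr => t _; rewrite -mulrBr.
  have gfar (t : 'I_n) : (D <= 2 * gap i t)%N -> (D <= 2 * gap i.+1 t)%N -> g t i = 0.
    by move=> *; rewrite /g !spike_far// subrr.
  set X := \sum_(t in J) _.
  pose A := \sum_(t in J | (t <= i)%N) s t * g t i.
  pose B := \sum_(t in J | ~~ (t <= i)%N) s t * g t i.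
  have XE : X = A + B by rewrite /X (bigID (fun t : 'I_n => (t <= i)%N)).
  have AE : A ^+ 2 = \sum_(t in J | (t <= i)%N) (s t * g t i) ^+ 2.
    apply: sqr_sum_disjoint => t t' /andP[tJ ti] /andP[t'J t'i] tt'.
    by rewrite (gfar t) ?mulr0 ?mul0r//; have := sepJ tJ t'J tt'; rewrite /gap; lia.
  have BE : B ^+ 2 = \sum_(t in J | ~~ (t <= i)%N) (s t * g t i) ^+ 2.
    apply: sqr_sum_disjoint => t t' /andP[tJ ti] /andP[t'J t'i] tt'.
    by rewrite (gfar t') ?mulr0//; have := sepJ tJ t'J tt'; rewrite /gap; lia.
  have ABle : A ^+ 2 + B ^+ 2 <= \sum_(t in J) g t i ^+ 2.
    rewrite AE BE -(bigID (fun t : 'I_n => (t <= i)%N)) /=.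
    apply: ler_sum => t _; rewrite exprMn -[leRHS]mul1r ler_wpM2r ?sqr_ge0//.
    by rewrite -real_normK ?num_real// expr_le1.
  rewrite XE; have := sqr_ge0 (A - B); lra.
apply: (@le_trans _ _ (n%:R * \sum_(i < n) 2 * \sum_(t in J) g t i ^+ 2)).
  by rewrite ler_wpM2l// ler_sum.
rewrite -mulr_sumr exchange_big /=.
have dS := delta_sum; have gS := g_sum.
set S := \sum_(d < n) delta d in gS dS.
have : \sum_(t in J) \sum_(i < n) g t i ^+ 2 <= #|J|%:R * (2 * S).
  rewrite mulr_natl -sumr_const; apply: ler_sum => t _; exact: g_sum.
have n0R : 0 < n%:R :> R by rewrite ltr0n.
have D0R : 0 < D%:R :> R by rewrite ltr0n.
have nD : 1 <= n%:R / D%:R :> R by rewrite ler_pdivlMr// mul1r ler_nat.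
have nS : n%:R * S <= (1 + ln n%:R) / 2 + 8 * (n%:R / D%:R).
  apply: le_trans (ler_wpM2l (ltW n0R) dS) _.
  rewrite le_eqVlt; apply/orP; left; apply/eqP; field; lra.
move=> h; apply: le_trans (ler_wpM2l (ltW n0R) (ler_wpM2l _ h)) _ => //.
have -> : n%:R * (2 * (#|J|%:R * (2 * S))) = 4 * #|J|%:R * (n%:R * S) by ring.
have -> : 2 * #|J|%:R * (ln n%:R + 17 * (n%:R / D%:R)) =
   4 * #|J|%:R * (ln n%:R / 2 + (17 / 2) * (n%:R / D%:R)) :> R by field; lra.
rewrite ler_wpM2l ?mulr_ge0//; lra.
Qed.

End Certificate.

(** * The deterministic oracle inequality *)

Lemma proj_sym (R : realType) (n : nat) (es : seq 'cV[R]_n) u v :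
  dot u (proj es v) = dot (proj es u) v.
Proof.
rewrite /proj dot_sumr dot_suml; apply: eq_bigr => e _.
by rewrite dotZr dotZl mulrC (dotC v).
Qed.

Section OracleInequality.
Context {R : realType} {n : nat}.
Implicit Types (f g y z : 'cV[R]_n) (es : seq 'cV[R]_n) (A : R).

Definition residual es j := step_vec j - proj es (step_vec j) : 'cV[R]_n.

Definition noise_controlled A es (J : {set 'I_n}) z : Prop :=
  (forall e, e \in es -> `|dot e z| <= A * Num.sqrt (dot e e)) /\
  (forall j, j \notin J ->
    `|dot (residual es j) z| <=
      A * Num.sqrt (dot (residual es j) (residual es j))).

(** The projected part of the noise is handled by Bessel's inequality and
    A x <= A^2 + x^2 / 4, coordinate by coordinate; in the remaining part the
    terms with j in J vanish. *)
Lemma noise_decomp A es (J : {set 'I_n}) z u : 0 <= A -> orthonormal_seq es ->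
  (forall t, t \in J -> proj es (step_vec t) = step_vec t) ->
  noise_controlled A es J z ->
  dot z u <= (size es)%:R * A ^+ 2 + dot u u / 4 +
    A * \sum_(j in ~: J)
      Num.sqrt (dot (residual es j) (residual es j)) * `|incr u j|.
Proof.
move=> A0 on rep [ze zr]; have [unit _] := on.
have -> : dot z u = \sum_(e <- es) dot u e * dot e z +
    \sum_(j < n) incr u j * dot (residual es j) z.
  have -> : \sum_(e <- es) dot u e * dot e z = dot z (proj es u).
    by rewrite dot_sumr; apply: eq_bigr => e _; rewrite dotZr (dotC z).
  have -> : \sum_(j < n) incr u j * dot (residual es j) z = dot (z - proj es z) u.
    rewrite [in RHS](step_decomp u) dot_sumr; apply: eq_bigr => j _.
    by rewrite dotZr (dotC _ z) /residual dotBr proj_sym -dotBl.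
  by rewrite proj_sym dotBl addrC subrK.
rewrite mulr_sumr; apply: lerD.
  apply: (@le_trans _ _ (\sum_(e <- es) (A ^+ 2 + dot u e ^+ 2 / 4))).
    rewrite big_seq [leRHS]big_seq; apply: ler_sum => e ein.
    have := ze e ein; rewrite unit// sqrtr1 mulr1 => h.
    apply: le_trans (ler_norm _) _; rewrite normrM.
    apply: le_trans (ler_wpM2l (normr_ge0 _) h) _.
    rewrite -(real_normK (num_real (dot u e))).
    have := sqr_ge0 (A - `|dot u e| / 2); nra.
  rewrite big_split /= big_const_seq count_predT iter_addr addr0 mulr_natl lerD2l.
  by rewrite -mulr_suml ler_pM2r ?invr_gt0// bessel.
rewrite (bigID (mem J)) /= big1 ?add0r => [|j jJ]; last first.
  by rewrite /residual rep// subrr dot0l mulr0.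
rewrite (eq_bigl (fun j => j \in (~: J)%SET)); last by move=> j; rewrite /= finset.in_setC.
apply: ler_sum => j; rewrite finset.in_setC => jJ.
apply: le_trans (ler_norm _) _; rewrite normrM mulrA mulrC.
by rewrite ler_wpM2r// zr.
Qed.

(** The vector c consists of the increments of the certificate built on the signs
    of the increments of u, so that <c, u> is the pairing of the certificate
    with these increments. *)
Lemma compatibility f u (w : 'I_n -> R) : (0 < n)%N ->
  (forall j, 0 <= w j <= Num.sqrt n%:R) ->
  (forall j t, t \in jumps f -> w j <= Num.sqrt (gap j t)%:R) ->
  exists c : 'cV[R]_n,
    n%:R * dot c c <= 2 * #|jumps f|%:R *
      (ln n%:R + 17 * (n%:R / (Delta_min (jumps f))%:R)) /\
    \sum_(j in jumps f) `|incr u j| -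
      \sum_(j in ~: jumps f) (1 - (2 * Num.sqrt n%:R)^-1 * w j) * `|incr u j|
    <= dot c u.
Proof.
move=> n0 w0 wJ; set J := jumps f.
pose s j := Num.sg (incr u j).
have s1 j : `|s j| <= 1 by rewrite normr_sg; case: eqP.
have D0 := Delta_min_gt0 J n0; have Dn := Delta_min_le J.
have sep := @Delta_min_sep _ J; have last_ := @Delta_min_last _ J.
pose q := dual_cert J s (Delta_min J).
exists (\col_i (q i - q i.+1)); split.
  have := dual_cert_energy s1 D0 Dn sep; congr (_ * _ <= _).
  by apply: eq_bigr => i _; rewrite mxE expr2.
rewrite -dot_diff; last exact: dual_cert_end.
rewrite [leRHS](bigID (mem J)) /= -sumrN; apply: lerD.
  apply: ler_sum => j jJ.
  by rewrite /q dual_cert_knot// /s -normrEsg.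
rewrite [leRHS](eq_bigl (fun j => j \in (~: J)%SET)); last by move=> j; rewrite /= finset.in_setC.
apply: ler_sum => j; rewrite finset.in_setC => jJ.
have /andP[wj0 wjn] := w0 j.
have feas := dual_cert_feasible s1 D0 Dn sep wj0 wjn (wJ j).
have : `|q j * incr u j| <= (1 - (2 * Num.sqrt n%:R)^-1 * w j) * `|incr u j|.
  by rewrite normrM ler_wpM2r.
by rewrite ler_norml => /andP[].
Qed.

(** As n lambda = 2 A n^(1/2), the noise term A |r_j| |beta_j| relaxes the
    penalty by the factor 1 - |r_j| / (2 n^(1/2)), so that noise and penalty
    together are at most 2 A n^(1/2) <c, u>; Young's inequality, used here and
    for the projected noise, leaves half of |u|^2 on the left-hand side. *)
Lemma oracle_inequality lambda A y f g es : (0 < n)%N -> 0 <= A ->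
  n%:R * lambda = 2 * A * Num.sqrt n%:R ->
  is_TV_estimator lambda y g -> orthonormal_seq es ->
  (forall t, t \in jumps f -> proj es (step_vec t) = step_vec t) ->
  noise_controlled A es (jumps f) (y - f) ->
  dot (g - f) (g - f) <= 2 * A ^+ 2 * ((size es)%:R + 8 * #|jumps f|%:R *
      (ln n%:R + 17 * (n%:R / (Delta_min (jumps f))%:R))).
Proof.
move=> n0 A0 nl est on rep noise; set u := g - f.
have n0R : 0 < n%:R :> R by rewrite ltr0n.
set r := Num.sqrt n%:R in nl *.
have r0 : 0 < r by rewrite sqrtr_gt0.
have r2 : r ^+ 2 = n%:R by rewrite sqr_sqrtr// ltW.
have l0 : 0 <= lambda.
  by rewrite -(pmulr_rge0 _ n0R) nl mulr_ge0 ?mulr_ge0// ltW.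
pose w j := Num.sqrt (dot (residual es j) (residual es j)).
have w0 j : 0 <= w j <= r.
  rewrite sqrtr_ge0 ler_wsqrtr//; apply: le_trans (step_sqnorm j).
  have p0 : proj es 0 = 0 by rewrite /proj big1// => e _; rewrite dot0l scale0r.
  by have := residual_le (step_vec j) on p0; rewrite subr0.
have wJ j t : t \in jumps f -> w j <= Num.sqrt (gap j t)%:R.
  move=> tJ; rewrite ler_wsqrtr//.
  apply: le_trans (residual_le _ on (rep t tJ)) _.
  apply: le_trans (step_sub_sqnorm _ _) _.
  rewrite /gap natrD; case: (leqP j t) => [jt|/ltnW tj].
    by rewrite (eqP jt) add0r natrB// distrC ger0_norm// subr_ge0 ler_nat.
  by rewrite (eqP tj) addr0 natrB// ger0_norm// subr_ge0 ler_nat.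
have [c [cn cu]] := compatibility u n0 w0 wJ.
have basic := TV_basic_inequality f n0 l0 est; rewrite -/u nl in basic.
have nd := noise_decomp u A0 on rep noise.
set SJ := \sum_(j in jumps f) _ in basic cu.
set SC := \sum_(j in ~: jumps f) _ in basic.
set SW := \sum_(j in ~: jumps f) _ in nd.
have cuE : SJ - SC + (2 * r)^-1 * SW <= dot c u.
  apply: le_trans cu; rewrite le_eqVlt; apply/orP; left; apply/eqP.
  rewrite -addrA; congr (_ + _); apply: oppr_inj.
  rewrite opprK opprD opprK mulr_sumr -sumrB.
  by apply: eq_bigr => j _; rewrite mulrBl mul1r mulrA.
have cuA : 2 * A * r * (SJ - SC) + A * SW <= 2 * A * r * dot c u.
  apply: le_trans (ler_wpM2l _ cuE); last by rewrite mulr_ge0 ?mulr_ge0// ltW.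
  rewrite le_eqVlt; apply/orP; left; apply/eqP; field; lra.
have yg : 2 * A * r * dot c u <= 4 * A ^+ 2 * (n%:R * dot c c) + dot u u / 4.
  have := @young_dot R n 1 (2 * A * r *: c) u ltr01.
  rewrite !dotZl !dotZr -r2; lra.
have A2 := ler_wpM2l (sqr_ge0 A) cn.
move: basic nd cuA yg A2; set U := dot u u; set X := dot (y - f) u; lra.
Qed.

End OracleInequality.

(** * Gaussian tails *)

Section GaussianTail.
Context {R : realType}.
Implicit Types (m s t v : R).
Local Notation mu := lebesgue_measure.

(** Completing the square: x^2 = m^2 + (x - m)^2 + 2 m (x - m). *)
Lemma normal_pdf_shift_le m s x : 0 < s -> 0 <= m * (x - m) ->
  normal_pdf 0 s x <= expR (- (m ^+ 2 / (2 * s ^+ 2))) * normal_pdf m s x.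
Proof.
move=> s0 mx; have sN0 : s != 0 by rewrite gt_eqF.
rewrite /normal_pdf (negbTE sN0) mulrCA ler_wpM2l ?normal_peak_ge0//.
rewrite /normal_fun -expRD ler_expR subr0 -subr_ge0.
set y := (X in 0 <= X).
have -> : y = m * (x - m) / s ^+ 2 by rewrite /y; field.
by rewrite divr_ge0 ?sqr_ge0.
Qed.

(** On B the centred density is dominated by a multiple of the density with mean
    m, whose total mass is 1. *)
Lemma normal_prob_shift_le m s (B : set R) : 0 < s -> measurable B ->
  (forall x, B x -> 0 <= m * (x - m)) ->
  (normal_prob 0 s B <= (expR (- (m ^+ 2 / (2 * s ^+ 2))))%:E)%E.
Proof.
move=> s0 mB Bm.
have mpdf m' : measurable_fun B (normal_pdf m' s).
  by apply/measurable_funTS; exact: measurable_normal_pdf.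
set e := expR _.
apply: (@le_trans _ _ (\int[mu]_(x in B) (e%:E * (normal_pdf m s x)%:E))%E).
  apply: ge0_le_integral => //=.
  - by move=> x _; rewrite lee_fin normal_pdf_ge0.
  - by apply/measurable_EFinP; exact: mpdf.
  - by apply: emeasurable_funM; [exact: measurable_cst|apply/measurable_EFinP; exact: mpdf].
  - by move=> x Bx; rewrite -EFinM lee_fin normal_pdf_shift_le// Bm.
rewrite ge0_integralZl//=; last 3 first.
- by apply/measurable_EFinP; exact: mpdf.
- by move=> x _; rewrite lee_fin normal_pdf_ge0.
- by rewrite lee_fin expR_ge0.
rewrite -[leRHS]mule1 lee_pmul2l// ?lte_fin ?expR_gt0//.
exact: (probability_le1 (normal_prob m s)).
Qed.

(** Each half-line is treated by a shift to its end point.  In the degenerate case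
    the Dirac mass at 0 does not charge the strict inequality. *)
Lemma normal_law_tail v t : 0 <= v -> 0 <= t ->
  (normal_law 0 v [set x | (Num.sqrt v * t < `|x|)%R] <=
   (2 * expR (- (t ^+ 2 / 2)))%:E)%E.
Proof.
move=> v0 t0; set B := [set x | _].
rewrite /normal_law; have [ve|vN0] := eqVneq v 0.
  rewrite diracE memNset ?lee_fin ?mulr_ge0 ?expR_ge0// /B /=.
  by rewrite ve sqrtr0 mul0r normr0 ltxx.
set s := Num.sqrt v in B *.
have s0 : 0 < s by rewrite sqrtr_gt0 lt_neqAle eq_sym vN0.
have -> : B = `]s * t, +oo[%classic `|` `]-oo, - (s * t)[%classic.
  apply/seteqP; split=> x; rewrite /B /= !in_itv /= andbT ltr_normr ltrNr.
    by move=> /orP[]; [left|right].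
  by move=> [] ->; rewrite ?orbT.
have st0 : 0 <= s * t by rewrite mulr_ge0// ltW.
apply: (le_trans (measureU2 (normal_prob 0 s) _ _)); [exact: measurable_itv..|].
have sE m' : m' ^+ 2 = (s * t) ^+ 2 -> - (t ^+ 2 / 2) = - (m' ^+ 2 / (2 * s ^+ 2)).
  by move=> ->; field; rewrite gt_eqF.
rewrite mulr_natl mulr2n EFinD; apply: leeD.
  rewrite (sE (s * t) erefl); apply: normal_prob_shift_le => // x /=.
  by rewrite in_itv /= andbT => /ltW h; rewrite mulr_ge0// subr_ge0.
rewrite (sE (- (s * t)) (sqrrN _)); apply: normal_prob_shift_le => // x /=.
by rewrite in_itv /= => /ltW h; rewrite mulNr -mulrN mulr_ge0//; lra.
Qed.

End GaussianTail.

Lemma measurable_norm_gt (R : realType) (d : measure_display)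
  (T : measurableType d) (f : T -> R) (c : R) :
  measurable_fun [set: T] f -> measurable [set w | c < `|f w|].
Proof.
move=> mf; have mnf : measurable_fun [set: T] (fun w => `|f w|).
  exact: measurableT_comp.
have := mnf measurableT `]c, +oo[%classic (measurable_itv _).
by rewrite setTI; congr measurable; apply/seteqP; split=> w;
  rewrite /= in_itv /= andbT.
Qed.


Section GaussianVector.
Context {R : realType} {d : measure_display} {T : measurableType d}.
Context {P : probability T R} {n : nat}.
Implicit Types (a : 'cV[R]_n) (X : T -> 'cV[R]_n) (sigma t : R).

Lemma measurable_linear_form X a :
  (forall i, measurable_fun [set: T] (fun w => X w i 0)) ->
  measurable_fun [set: T] (fun w => dot a (X w)).
Proof.
move=> mX; apply: measurable_sum => i.
by apply: measurable_funM => //; exact: measurable_cst.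
Qed.

Lemma gaussian_linear_form_tail X sigma t a :
  gaussian_vector P X 0 (sigma ^+ 2)%:M -> 0 <= sigma -> 0 <= t ->
  (P [set w | (sigma * t * Num.sqrt (dot a a) < `|dot a (X w)|)%R] <=
   (2 * expR (- (t ^+ 2 / 2)))%:E)%E.
Proof.
move=> [_ law] sg0 t0.
have vE : (a^T *m (sigma ^+ 2)%:M *m a) 0 0 = sigma ^+ 2 * dot a a.
  by rewrite mul_mx_scalar -scalemxAl mxE mul_trE.
have v0 : 0 <= sigma ^+ 2 * dot a a by rewrite mulr_ge0 ?sqr_ge0 ?dot_ge0.
apply: le_trans (normal_law_tail v0 t0).
have -> : Num.sqrt (sigma ^+ 2 * dot a a) * t = sigma * t * Num.sqrt (dot a a).
  by rewrite sqrtrM ?sqr_ge0// sqrtr_sqr ger0_norm// mulrAC.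
have := law a [set x | sigma * t * Num.sqrt (dot a a) < `|x|].
rewrite mulmx0 [X in normal_law X]mxE vE => <-.
  rewrite le_eqVlt; apply/orP; left; apply/eqP; congr (P _).
  by apply/seteqP; split=> w /=; rewrite mul_trE.
exact: measurable_norm_gt.
Qed.

Lemma gaussian_union_bound X sigma t (S : seq 'cV[R]_n) :
  gaussian_vector P X 0 (sigma ^+ 2)%:M -> 0 <= sigma -> 0 <= t ->
  let G := [set w | forall a, a \in S ->
     (`|dot a (X w)| <= sigma * t * Num.sqrt (dot a a))%R] in
  measurable G /\
  ((1 - (size S)%:R * (2 * expR (- (t ^+ 2 / 2))))%:E <= P G)%E.
Proof.
move=> gX sg0 t0 G; have [mX _] := gX.
set e := 2 * expR _.
pose bad a := [set w | (sigma * t * Num.sqrt (dot a a) < `|dot a (X w)|)%R].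
have mbad a : measurable (bad a).
  by apply: measurable_norm_gt; exact: measurable_linear_form.
pose F := \big[setU/set0]_(a <- S) bad a.
have mF : measurable F by apply: bigsetU_measurable.
have PF : (P F <= ((size S)%:R * e)%:E)%E.
  rewrite /F; elim: (S) => [|a S' IH]; first by rewrite big_nil measure0 mul0r.
  rewrite big_cons (le_trans (measureU2 _ _ _))//; first exact: bigsetU_measurable.
  rewrite /= mulrS mulrDl mul1r EFinD.
  by apply: leeD => //; exact: gaussian_linear_form_tail.
have GE : G = ~` F.
  rewrite /F; apply/seteqP; split => [w Gw|w].
    rewrite -bigcup_seq => -[a /= aS]; rewrite /bad /=.
    by apply/negP; rewrite -leNgt; exact: Gw.
  rewrite -bigcup_seq => nF a aS; rewrite leNgt; apply/negP => h.
  by apply: nF; exists a.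
split; first by rewrite GE; exact: measurableC.
by rewrite GE probability_setC// EFinB leeB.
Qed.

End GaussianVector.

(** * Measurability of the estimator *)

Lemma rat_approx (R : realType) (x e : R) : 0 < e ->
  exists q : rat, `|x - ratr q| < e.
Proof.
move=> e0; have [q] := @rat_in_itvoo R (x - e) (x + e) ltac:(lra).
rewrite in_itv /= => /andP[h1 h2]; exists q.
by rewrite ltr_distlC; apply/andP; split; lra.
Qed.

(** The set {c < g} is a countable union of preimages of rational cubes: around
    each of its points w there is a rational cube of X-values, of side at most
    (g w - c) / (n + 1), on which the Lipschitz property keeps g above c.
    Countability is obtained without factoring g through X. *)
Lemma measurable_of_lipschitz (R : realType) (d : measure_display)
    (T : measurableType d) (n : nat) (X : T -> 'cV[R]_n) (g : T -> R) :
  (forall i, measurable_fun [set: T] (fun w => X w i 0)) ->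
  (forall w w', (g w - g w') ^+ 2 <= dot (X w - X w') (X w - X w')) ->
  measurable_fun [set: T] g.
Proof.
move=> mX lip.
suff mgt c : measurable [set w | c < g w].
  apply: (measurability _ (RGenOInfty.measurableE R)) => _ [_ [c ->] <-].
  rewrite setTI; have := mgt c; congr measurable.
  by apply/seteqP; split=> w /=; rewrite in_itv /= andbT.
pose box (k : {ffun 'I_n -> rat} * rat) : set T :=
  [set w | forall i, `|X w i 0 - ratr (k.1 i)| < ratr k.2].
have mbox k : measurable (box k).
  have -> : box k = \bigcap_(i in [set: 'I_n])
      (fun w => `|X w i 0 - ratr (k.1 i)|) @^-1` `]-oo, ratr k.2[%classic.
    apply/seteqP; split=> w /= h i; first by move=> _; rewrite /= in_itv /= h.
    by have := h i I; rewrite /= in_itv.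
  apply: fin_bigcap_measurable => // i _; rewrite -[X in measurable X]setTI.
  have mi : measurable_fun [set: T] (fun w => `|X w i 0 - ratr (k.1 i)|).
    apply: measurableT_comp => //; apply: measurable_funB => //.
  exact: mi.
have -> : [set w | c < g w] =
    \bigcup_k (if `[< box k `<=` [set w | c < g w] >] then box k else set0).
  apply/seteqP; split=> w /=; last first.
    by move=> [k _]; case: ifPn => // /asboolP; apply.
  move=> cg.
  (* n squares of size (2 e)^2 add up to less than (g w - c)^2. *)
  pose e := (g w - c) / (2 * n.+1%:R).
  have n1 : 0 < n.+1%:R :> R by rewrite ltr0n.
  have e0 : 0 < e by rewrite divr_gt0 ?mulr_gt0 ?subr_gt0.
  have [r] := @rat_in_itvoo R 0 e e0.
  rewrite in_itv /= => /andP[r0 re].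
  have app i : {q : rat | `|X w i 0 - ratr q| < ratr r}.
    by apply: cid; exact: rat_approx.
  pose k : {ffun 'I_n -> rat} * rat := ([ffun i => sval (app i)], r).
  have wk : box k w by move=> i /=; rewrite ffunE; exact: (svalP (app i)).
  exists k => //; case: asboolP => // bad; exfalso; apply: bad.
  move=> w' w'k /=; rewrite ltNge; apply/negP => g'c.
  have := lip w w'; apply/negP; rewrite -ltNge.
  have dle : dot (X w - X w') (X w - X w') <= \sum_(i < n) (2 * e) ^+ 2.
    apply: ler_sum => i _; rewrite !mxE -expr2 -real_normK ?num_real//.
    have e20 : 0 <= 2 * e by rewrite mulr_ge0// ltW.
    rewrite ler_sqr ?nnegrE ?normr_ge0//.
    rewrite (_ : _ - _ = (X w i 0 - ratr (k.1 i)) - (X w' i 0 - ratr (k.1 i))); last by ring.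
    apply: le_trans (ler_normB _ _) _; have := wk i; have := w'k i => /=; lra.
  apply: le_lt_trans dle _; rewrite sumr_const card_ord -[ltLHS]mulr_natr.
  have e2 : 2 * e * n.+1%:R = g w - c by rewrite /e; field; lra.
  have nn : n%:R < n.+1%:R :> R by rewrite ltr_nat.
  have n1' : 1 <= n.+1%:R :> R by rewrite ler1n.
  have : (2 * e * n.+1%:R) ^+ 2 <= (g w - g w') ^+ 2.
    by rewrite ler_sqr ?nnegrE; lra.
  apply: lt_le_trans; rewrite [ltRHS]exprMn ltr_pM2l; last by rewrite exprn_gt0// mulr_gt0.
  nra.
apply: countable_bigcupT_measurable => // k; case: ifP => // _; exact: measurable0.
Qed.

Lemma coord_sqr_le (R : realType) (n : nat) (u : 'cV[R]_n) i :
  u i 0 ^+ 2 <= dot u u.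
Proof.
rewrite /dot (bigD1 i)//= -expr2 lerDl; apply: sumr_ge0 => j _.
by rewrite -expr2 sqr_ge0.
Qed.

Lemma TV_estimator_measurable (R : realType) (d : measure_display)
    (T : measurableType d) (n : nat) (lambda : R) (f : 'cV[R]_n)
    (xi fhat : T -> 'cV[R]_n) i :
  (0 < n)%N -> 0 <= lambda ->
  (forall i, measurable_fun [set: T] (fun w => xi w i 0)) ->
  (forall w, is_TV_estimator lambda (f + xi w) (fhat w)) ->
  measurable_fun [set: T] (fun w => fhat w i 0).
Proof.
move=> n0 l0 mxi est; apply: (measurable_of_lipschitz mxi) => w w'.
have := coord_sqr_le (fhat w - fhat w') i; rewrite !mxE => /le_trans; apply.
have := TV_estimator_lipschitz n0 l0 (est w) (est w').
by rewrite opprD addrACA subrr add0r.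
Qed.

(** * The risk bound *)

Theorem mainTheorem7 (R : realType) (d : measure_display)
  (T : measurableType d) (P : probability T R) (n : nat)
  (fstar : 'cV[R]_n) (sigma delta lambda : R)
  (xi fhat : T -> 'cV[R]_n)
  (hJ : jumps fstar != finset.set0)
  (hsigma : 0 < sigma)
  (hdelta0 : 0 < delta) (hdelta1 : delta < 1)
  (hlambda : lambda = 2 * sigma * Num.sqrt (2 / n%:R * ln (n%:R / delta)))
  (hxi : gaussian_vector P xi 0 (sigma ^+ 2)%:M)
  (hfhat : forall w, is_TV_estimator lambda (fstar + xi w) (fhat w)) :
  ((1 - 2 * delta)%:E <=
   P [set w | (n%:R^-1 * sqnorm2 (fhat w - fstar) <=
       4 * sigma ^+ 2 * #|jumps fstar|%:R * ln (n%:R / delta) / n%:R *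
       (3 + 256 * (ln n%:R + n%:R / (Delta_min (jumps fstar))%:R)))%R])%E.
Proof.
have n0 : (0 < n)%N by case/finset.set0Pn: hJ => j _; exact: leq_ltn_trans (ltn_ord j).
have n0R : 0 < n%:R :> R by rewrite ltr0n.
have n1R : 1 <= n%:R :> R by rewrite ler1n.
have nd1 : 1 < n%:R / delta by rewrite ltr_pdivlMr// mul1r (lt_le_trans hdelta1).
set L := ln (n%:R / delta) in hlambda *.
have L0 : 0 < L by exact: ln_gt0.
set J := jumps fstar in hJ *.
set r := Num.sqrt n%:R : R; set t := Num.sqrt (2 * L).
have r0 : 0 < r by rewrite sqrtr_gt0.
have r2 : r ^+ 2 = n%:R by rewrite sqr_sqrtr// ltW.
have t0 : 0 <= t by exact: sqrtr_ge0.
have t2 : t ^+ 2 = 2 * L by rewrite sqr_sqrtr// mulr_ge0// ltW.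
have nl : n%:R * lambda = 2 * (sigma * t) * r.
  rewrite hlambda.
  have -> : 2 / n%:R * L = 2 * L * n%:R^-1 by ring.
  rewrite sqrtrM ?mulr_ge0 ?(ltW L0)// sqrtrV ?(ltW n0R)// -/t -/r -r2.
  by field; rewrite gt_eqF.
have l0 : 0 <= lambda by rewrite hlambda mulr_ge0 ?sqrtr_ge0// mulr_ge0// ltW.
have [es [size_es on rep]] := gram_schmidt [seq (step_vec j : 'cV[R]_n) | j <- enum J].
have {}rep j : j \in J -> proj es (step_vec j) = step_vec j :> 'cV[R]_n.
  by move=> jJ; apply/rep/map_f; rewrite mem_enum.
rewrite size_map -cardE in size_es.
(* At most s + (n - s) = n linear forms have to be controlled. *)
pose S := es ++ [seq residual es j | j <- enum (~: J)%SET].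
have size_S : (size S <= n)%N.
  rewrite size_cat size_map -cardE -[leqRHS]card_ord -(cardsC J).
  by rewrite leq_add2r.
have [mG PG] := gaussian_union_bound S hxi (ltW hsigma) t0.
set G := [set w | _] in mG PG.
set E := [set w | _].
have mE : measurable E.
  have mf : measurable_fun [set: T] (fun w => sqnorm2 (fhat w - fstar)).
    apply: measurable_sum => i; apply: measurable_funX.
    under eq_fun do rewrite !mxE.
    apply: measurable_funB => //.
    exact: (TV_estimator_measurable i n0 l0 hxi.1 hfhat).
  have mg : measurable_fun [set: T] (fun w => n%:R^-1 * sqnorm2 (fhat w - fstar)).
    by apply: measurable_funM.
  have := mg measurableT _ (measurable_itv `]-oo, (4 * sigma ^+ 2 * #|J|%:R * L / n%:R *
       (3 + 256 * (ln n%:R + n%:R / (Delta_min J)%:R)))]).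
  by rewrite setTI; congr measurable; apply/seteqP; split=> w; rewrite /E /= in_itv.
have GE : G `<=` E.
  move=> w Gw; rewrite /E /=.
  have A0 : 0 <= sigma * t by rewrite mulr_ge0// ltW.
  have noise : noise_controlled (sigma * t) es J (fstar + xi w - fstar).
    rewrite addrAC subrr add0r; split=> [e ein|j jJ]; apply: Gw.
      by rewrite mem_cat ein.
    by rewrite mem_cat map_f ?orbT// mem_enum finset.in_setC.
  have := oracle_inequality n0 A0 nl (hfhat w) on rep noise.
  rewrite sqnorm2E -/J exprMn t2.
  set U := dot _ _; set K := ln n%:R; set D := n%:R / (Delta_min J)%:R => h.
  have K0 : 0 <= K by exact: ln_ge0.
  have D0 : 0 <= D by rewrite divr_ge0.
  have J0 : 0 <= #|J|%:R :> R by [].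
  rewrite mulrC ler_pdivrMr// mulrAC divfK ?gt_eqF//.
  apply: le_trans h _.
  have -> : 4 * sigma ^+ 2 * #|J|%:R * L * (3 + 256 * (K + D)) =
    2 * (sigma ^+ 2 * (2 * L)) * (#|J|%:R * (3 + 256 * (K + D))) by ring.
  have c0 : 0 <= 2 * (sigma ^+ 2 * (2 * L)).
    by rewrite -t2 -exprMn mulr_ge0 ?sqr_ge0.
  apply: ler_wpM2l c0 _ _ _.
  have : (size es)%:R <= #|J|%:R :> R by rewrite ler_nat.
  nra.
have PGE : (P G <= P E)%E by rewrite le_measure ?inE.
apply: (le_trans _ PGE); apply: (le_trans _ PG); rewrite lee_fin lerD2l lerN2 mulrCA ler_wpM2l//.
have -> : expR (- (t ^+ 2 / 2)) = delta / n%:R.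
  rewrite t2 mulrAC mulfV// mul1r expRN lnK ?invf_div//.
  by rewrite posrE divr_gt0.
by rewrite mulrCA ler_piMr ?(ltW hdelta0)// ler_pdivrMr// mul1r ler_nat.
Qed.
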